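(* Let $N\ge1$, $h,l>0$, $(\alpha,\beta)\in\mathbb R^2\setminus\{(0,0)\}$ and $\theta\in\mathbb R^3$ with $\theta_1\theta_2\theta_3\ne0$. For the $N$-resonator system described in the context, with vertex conditions of type I or of type II, the transmission probability $T(k)=T(k;\theta_1,\theta_2,\theta_3)$ is invariant under interchange of $\theta_1$ and $\theta_2$: for every $k>0$, $$T(k;\theta_1,\theta_2,\theta_3)=T(k;\theta_2,\theta_1,\theta_3).$$
   Context: Model. The metric graph $G$ has vertices $v_1,\dots,v_N$ of degree 3, placed on the real line (the channel) at $x_j=(j-1)h$, and vertices $u_1,\dots,u_N$ of degree 1. The channel consists of the leads $e_{in}=(-\infty,0]$ (ending at $v_1$), $e_{out}=[(N-1)h,+\infty)$ (starting at $v_N$), and the segments of length $h$ between consecutive $v_j$'s. At each $v_j$ a resonator edge $(v_j,u_j)$ of length $l$ is attached, with coordinate $s\in[0,l]$, $s=0$ at $v_j$ and $s=l$ at $u_j$. At $v=v_j$, $\psi_1(v),\psi_2(v),\psi_3(v)$ denote the limits of $\psi$ at $v$ along the left channel edge, the right channel edge and the resonator edge, and $\psi_i'(v)$ the corresponding one-sided derivatives taken in the direction from $v$ into the edge. Vertex conditions at every $v_j$. Type I: $\frac{\psi_1(v)}{\theta_1}=\frac{\psi_2(v)}{\theta_2}=\frac{\psi_3(v)}{\theta_3}$ and $\theta_1\psi_1'(v)+\theta_2\psi_2'(v)+\theta_3\psi_3'(v)=0$. Type II: $\frac{\psi_1'(v)}{\theta_1}=\frac{\psi_2'(v)}{\theta_2}=\frac{\psi_3'(v)}{\theta_3}$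 and $\theta_1\psi_1(v)+\theta_2\psi_2(v)+\theta_3\psi_3(v)=0$. Endpoint condition at each $u_j$: $\alpha\psi+\beta\frac{d\psi}{ds}=0$ at $s=l$. Scattering solution at wavenumber $k>0$: a function $\psi$ on $G$ with $\psi''+k^2\psi=0$ on every edge, satisfying all vertex and endpoint conditions, with $\psi(x)=e^{ikx}+r(k)e^{-ikx}$ on $e_{in}$ and $\psi(x)=t(k)e^{ikx}$ on $e_{out}$. The amplitudes are uniquely determined; the transmission probability is $T(k)=|t(k)|^2$. All parameters other than those displayed in $T(k;\theta_1,\theta_2,\theta_3)$, and the type of vertex conditions, are kept fixed. *)

(* Defs.v *)
From Stdlib Require Export Reals.
From Stdlib Require Import ClassicalEpsilon.
From Coquelicot Require Export Coquelicot.

Open Scope R_scope.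

Inductive vertex_type := TypeI | TypeII.

(* [Channel j], 0 <= j <= N: the part of the channel between v_j and v_(j+1);
   [Channel 0] is the lead e_in and [Channel N] is the lead e_out.
   [Resonator j], 1 <= j <= N: the edge (v_j, u_j).
   Channel edges carry the coordinate x of the line, resonators the coordinate
   s in [0, l].  Other indices do not belong to the graph. *)
Inductive edge := Channel (j : nat) | Resonator (j : nat).

Definition is_edge (N : nat) (e : edge) : Prop :=
  match e with
  | Channel j => (j <= N)%nat
  | Resonator j => (1 <= j <= N)%nat
  end.

(* Coordinate x_j of v_j; vertices are numbered from 1. *)
Definition vertex_pos (h : R) (j : nat) : R := (INR j - 1) * h.

Definition edge_lower (h : R) (e : edge) : Rbar :=
  match e with
  | Channel O => m_infty
  | Channel j => Finite (vertex_pos h j)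
  | Resonator _ => Finite 0
  end.

Definition edge_upper (N : nat) (h l : R) (e : edge) : Rbar :=
  match e with
  | Channel j => if Nat.eqb j N then p_infty else Finite (vertex_pos h (S j))
  | Resonator _ => Finite l
  end.

(* psi'' + k^2 psi = 0 in the open interval (lo, hi); dpsi is psi'. *)
Definition helmholtz (k : R) (lo hi : Rbar) (psi : R -> C) : Prop :=
  exists dpsi : R -> C, forall x : R, Rbar_lt lo x -> Rbar_lt x hi ->
    is_derive psi x (dpsi x) /\
    is_derive dpsi x (Copp (Cmult (RtoC (k ^ 2)) (psi x))).

(* At the end a of an edge, with dir = 1 or -1 the direction from a into the
   edge: p is the limit of f along the edge and q is its one-sided derivative
   taken in that direction.  The value f a itself plays no role, since functions
   on the graph may be discontinuous at the vertices. *)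
Definition end_data (f : R -> C) (a dir : R) (p q : C) : Prop :=
  filterlim (fun eps : R => f (a + dir * eps)) (at_right 0) (locally p) /\
  filterlim (fun eps : R => Cdiv (Cminus (f (a + dir * eps)) p) (RtoC eps))
    (at_right 0) (locally q).

Definition vertex_relation (vt : vertex_type) (theta1 theta2 theta3 : R)
    (p1 p2 p3 q1 q2 q3 : C) : Prop :=
  match vt with
  | TypeI =>
      (p1 / theta1 = p2 / theta2)%C /\ (p2 / theta2 = p3 / theta3)%C /\
      (theta1 * q1 + theta2 * q2 + theta3 * q3 = 0)%C
  | TypeII =>
      (q1 / theta1 = q2 / theta2)%C /\ (q2 / theta2 = q3 / theta3)%C /\
      (theta1 * p1 + theta2 * p2 + theta3 * p3 = 0)%C
  end.

Definition vertex_condition (vt : vertex_type) (h theta1 theta2 theta3 : R)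
    (psi : edge -> R -> C) (j : nat) : Prop :=
  exists p1 p2 p3 q1 q2 q3 : C,
    end_data (psi (Channel (Nat.pred j))) (vertex_pos h j) (-1) p1 q1 /\
    end_data (psi (Channel j)) (vertex_pos h j) 1 p2 q2 /\
    end_data (psi (Resonator j)) 0 1 p3 q3 /\
    vertex_relation vt theta1 theta2 theta3 p1 p2 p3 q1 q2 q3.

(* alpha psi + beta dpsi/ds = 0 at s = l.  The derivative q into the edge is
   -dpsi/ds there. *)
Definition endpoint_condition (l alpha beta : R)
    (psi : edge -> R -> C) (j : nat) : Prop :=
  exists p q : C,
    end_data (psi (Resonator j)) l (-1) p q /\
    (alpha * p + beta * (- q) = 0)%C.

(* exp (i y) *)
Definition cis (y : R) : C := (cos y, sin y).

Definition scattering_solution (vt : vertex_type) (N : nat)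
    (h l alpha beta theta1 theta2 theta3 k : R)
    (psi : edge -> R -> C) (r t : C) : Prop :=
  (forall e : edge, is_edge N e ->
     helmholtz k (edge_lower h e) (edge_upper N h l e) (psi e)) /\
  (forall j : nat, (1 <= j <= N)%nat ->
     vertex_condition vt h theta1 theta2 theta3 psi j) /\
  (forall j : nat, (1 <= j <= N)%nat ->
     endpoint_condition l alpha beta psi j) /\
  (forall x : R, x <= 0 ->
     psi (Channel 0) x = (cis (k * x) + r * cis (- (k * x)))%C) /\
  (forall x : R, vertex_pos h N <= x ->
     psi (Channel N) x = (t * cis (k * x))%C).

(* For admissible parameters there is exactly one such t, by flux conservation;
   psi itself need not be unique (bound states embedded in the continuum). *)
Definition transmission_amplitude (vt : vertex_type) (N : nat)
    (h l alpha beta theta1 theta2 theta3 k : R) : C :=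
  epsilon (inhabits (RtoC 0)) (fun t : C =>
    exists (psi : edge -> R -> C) (r : C),
      scattering_solution vt N h l alpha beta theta1 theta2 theta3 k psi r t).

Definition transmission_probability (vt : vertex_type) (N : nat)
    (h l alpha beta theta1 theta2 theta3 k : R) : R :=
  Cmod (transmission_amplitude vt N h l alpha beta theta1 theta2 theta3 k) ^ 2.

(* Main.v *)
Require Import Defs.
From Stdlib Require Import ssreflect Lra Lia ClassicalEpsilon.
From Stdlib Require Import FunctionalExtensionality PropExtensionality.

(** Interchanging theta1 and theta2 amounts to reflecting the graph.  The proof shows
    that the two systems have exactly the same set of transmission amplitudes t
    ([swap_scattering_solution]), so that the same amplitude is selected for both.

    On each edge the solutions of psi'' + k^2 psi = 0 are A cos(kx) + B sin(kx), so a
    scattering solution is the same as a family of coefficient pairs that has the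
    prescribed form on the leads and satisfies the vertex and endpoint conditions
    ([scattering_to_waves], [waves_scattering]).  These conditions are linear
    equations with real coefficients.  They are therefore stable under complex
    conjugation (time reversal) and complex linear combinations, and the reflection
    x -> (N-1)h - x turns them into the equations with theta1 and theta2 exchanged.

    If t <> 0, let psi be a solution with amplitudes r, t.  The combination
    conj psi - conj r psi has no incoming wave on the left lead: it is
    (1 - |r|^2) e^(-ikx) there.  Its reflection, divided by conj t up to a phase, is
    a scattering solution for the exchanged parameters with transmission amplitude
    (1 - |r|^2) / conj t.  Flux conservation gives 1 - |r|^2 = |t|^2
    ([scattering_unitary]), so this amplitude is t again ([reciprocity]).

    If t = 0, the vanishing of the wave propagates backwards from the right lead
    through the vertices, and it can stop only at a vertex whose resonator supports
    a blocking mode ([zero_transmission_blocked]); it must stop, because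
    the wave on the left lead is not zero.  Since all resonators are alike, the
    first one then blocks the channel for any theta, in particular for the exchanged
    parameters ([total_reflection]). *)

(** * Waves on an edge *)

Definition value (k : R) (w : C * C) (x : R) : C :=
  (fst w * cos (k * x) + snd w * sin (k * x))%C.
Definition slope (k : R) (w : C * C) (x : R) : C :=
  (k * (snd w * cos (k * x) - fst w * sin (k * x)))%C.

(* After unfolding the module operations an equation between reals is still typed
   in an abstract structure, where ring does not recognize it. *)
Ltac real_ring := match goal with |- @eq _ ?a ?b => change (@eq R a b) end; ring.

Lemma C_ext (a b : C) : fst a = fst b -> snd a = snd b -> a = b.
Proof. by destruct a, b; simpl; intros -> ->. Qed.

(** Real-variable arguments apply to the real and imaginary parts, which are
    continuous linear images of the derivative in the real normed module C. *)
Lemma is_derive_fst (f : R -> C) (x : R) (d : C) :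
  is_derive f x d -> is_derive (fun y => fst (f y)) x (fst d).
Proof.
  intros H.
  apply (filterdiff_ext_lin _ (fun y : R => fst (scal y d : C))).
  - apply: (filterdiff_comp' f (fst : C -> R) x (fun y : R => scal y d) fst H).
    apply filterdiff_linear, is_linear_fst.
  - reflexivity.
Qed.

Lemma is_derive_snd (f : R -> C) (x : R) (d : C) :
  is_derive f x d -> is_derive (fun y => snd (f y)) x (snd d).
Proof.
  intros H.
  apply (filterdiff_ext_lin _ (fun y : R => snd (scal y d : C))).
  - apply: (filterdiff_comp' f (snd : C -> R) x (fun y : R => scal y d) snd H).
    apply filterdiff_linear, is_linear_snd.
  - reflexivity.
Qed.

Lemma is_derive_value k w x : is_derive (value k w) x (slope k w x).
Proof.
  apply (is_derive_ext (fun y : R =>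
    plus (scal (cos (k * y)) (fst w)) (scal (sin (k * y)) (snd w)))).
  - intros y. apply C_ext; rewrite /value /scal /plus /= /prod_scal /scal /= /mult /= /plus /=; real_ring.
  - replace (slope k w x) with
     (plus (scal (- k * sin (k * x)) (fst w)) (scal (k * cos (k * x)) (snd w))).
    + apply: (is_derive_plus (V := prod_NormedModule R_AbsRing R_NormedModule R_NormedModule));
        apply: is_derive_scal_l; auto_derive; trivial; ring.
    + apply C_ext; rewrite /slope /scal /plus /= /prod_scal /scal /= /mult /= /plus /=; real_ring.
Qed.

Lemma is_derive_slope k w x :
  is_derive (slope k w) x (- (RtoC (k ^ 2) * value k w x))%C.
Proof.
  have E v y : slope k v y = value k (k * snd v, - (k * fst v))%C y.
  { rewrite /slope /value /=; ring. }
  apply (is_derive_ext (value k (k * snd w, - (k * fst w))%C)).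
  { intros y. symmetry. apply E. }
  replace (- (RtoC (k ^ 2) * value k w x))%C with (slope k (k * snd w, - (k * fst w))%C x).
  { apply is_derive_value. }
  rewrite /slope /value /= RtoC_mult RtoC_mult; ring.
Qed.

Lemma filterlim_C (F : (R -> Prop) -> Prop) {FF : Filter F} (f : R -> C) (p : C) :
  filterlim (fun t => fst (f t)) F (locally (fst p)) ->
  filterlim (fun t => snd (f t)) F (locally (snd p)) ->
  filterlim f F (locally p).
Proof.
  intros H1 H2. apply filterlim_locally. intros eps.
  generalize (proj1 (filterlim_locally _ _) H1 eps) (proj1 (filterlim_locally _ _) H2 eps).
  intros A B. generalize (filter_and _ _ A B). apply filter_imp.
  intros x [Ha Hb]. by split.
Qed.

Lemma at_right_pos : at_right 0 (fun eps => 0 < eps).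
Proof. exists posreal_one. intros y _ Hy. exact Hy. Qed.

Lemma end_data_real (g : R -> R) (a dir d : R) :
  is_derive g a d ->
  filterlim (fun eps => g (a + dir * eps)) (at_right 0) (locally (g a)) /\
  filterlim (fun eps => (g (a + dir * eps) - g a) / eps) (at_right 0)
    (locally (dir * d)).
Proof.
  intros H.
  assert (K : is_derive (fun e : R => g (a + dir * e)) 0 (dir * d)).
  { apply: (is_derive_comp g (fun e => a + dir * e)).
    - by rewrite Rmult_0_r Rplus_0_r.
    - auto_derive; trivial. ring. }
  split.
  - apply: (filterlim_filter_le_1 (F := locally 0)).
    { intros P HP. apply filter_le_within. exact HP. }
    have C : continuous (fun e : R => g (a + dir * e)) 0
      by apply: ex_derive_continuous; eexists; exact K.
    move: C. by rewrite /continuous Rmult_0_r Rplus_0_r.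
  - apply is_derive_Reals in K. apply filterlim_locally. intros eps.
    destruct (K eps (cond_pos eps)) as [del Hdel].
    exists del. intros y Hy Hy0.
    have := Hdel y ltac:(lra)
      ltac:(by move: Hy; rewrite /ball /= /AbsRing_ball /abs /minus /plus /opp /= Ropp_0 Rplus_0_r).
    by rewrite Rmult_0_r Rplus_0_l Rplus_0_r.
Qed.

Lemma end_data_derive (f : R -> C) (a dir : R) (d : C) :
  is_derive f a d -> end_data f a dir (f a) (dir * d)%C.
Proof.
  intros H.
  destruct (end_data_real _ a dir _ (is_derive_fst _ _ _ H)) as [A1 B1].
  destruct (end_data_real _ a dir _ (is_derive_snd _ _ _ H)) as [A2 B2].
  split; apply: filterlim_C; try assumption.
  - replace (fst (dir * d)%C) with (dir * fst d) by (simpl; ring).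
    refine (filterlim_ext_loc _ _ _ B1). move: at_right_pos. apply filter_imp => y Hy /=.
    field. lra.
  - replace (snd (dir * d)%C) with (dir * snd d) by (simpl; ring).
    refine (filterlim_ext_loc _ _ _ B2). move: at_right_pos. apply filter_imp => y Hy /=.
    field. lra.
Qed.

(** Values and one-sided derivatives at an end depend only on the function inside
    the edge near that end. *)
Lemma end_data_unique (f g : R -> C) (a dir : R) (p q p' q' : C) :
  at_right 0 (fun eps => f (a + dir * eps) = g (a + dir * eps)) ->
  end_data f a dir p q -> end_data g a dir p' q' -> p = p' /\ q = q'.
Proof.
  intros E [H1 H2] [H1' H2'].
  have Ep : p = p'.
  { apply: (filterlim_locally_unique (F := at_right 0) (fun eps => g (a + dir * eps))); last done.
    refine (filterlim_ext_loc _ _ _ H1). exact E. }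
  split; first done. subst p'.
  apply: (filterlim_locally_unique (F := at_right 0)); last exact H2'.
  refine (filterlim_ext_loc _ _ _ H2). move: E. by apply filter_imp => y ->.
Qed.

Lemma RtoC_m1 : RtoC (-1) = (- (1))%C.
Proof. apply C_ext; simpl; lra. Qed.

Lemma derive_zero_constant (lo hi : Rbar) (f : R -> R) :
  (forall x : R, Rbar_lt lo x -> Rbar_lt x hi -> is_derive f x 0) ->
  forall x y : R, Rbar_lt lo x -> Rbar_lt x hi -> Rbar_lt lo y -> Rbar_lt y hi ->
  f x = f y.
Proof.
  intros H.
  assert (K : forall x y : R, Rbar_lt lo x -> Rbar_lt y hi -> x < y -> f x = f y).
  { intros x y Hx Hy Hxy. apply: eq_is_derive; last exact Hxy.
    intros t Ht. apply H.
    - apply Rbar_lt_le_trans with x; [done | apply Ht].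
    - apply Rbar_le_lt_trans with y; [apply Ht | done]. }
  intros x y Hx1 Hx2 Hy1 Hy2. destruct (Rtotal_order x y) as [L | [E | G]].
  - by apply K.
  - by rewrite E.
  - symmetry. by apply K.
Qed.

(** Variation of constants: u cos - (u'/k) sin and u sin + (u'/k) cos have zero
    derivative, and they are the coefficients of u. *)
Lemma helmholtz_real (k : R) (lo hi : Rbar) (u du : R -> R) :
  k <> 0 ->
  (forall x : R, Rbar_lt lo x -> Rbar_lt x hi ->
     is_derive u x (du x) /\ is_derive du x (- (k ^ 2 * u x))) ->
  exists a b : R, forall x : R, Rbar_lt lo x -> Rbar_lt x hi ->
    u x = a * cos (k * x) + b * sin (k * x).
Proof.
  intros Hk H.
  destruct (classic (exists x0 : R, Rbar_lt lo x0 /\ Rbar_lt x0 hi)) as [[x0 [L0 U0]] | Hno].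
  2: { exists 0, 0. intros x L U. exfalso. apply Hno. by exists x. }
  set A := fun x => u x * cos (k * x) - du x / k * sin (k * x).
  set B := fun x => u x * sin (k * x) + du x / k * cos (k * x).
  exists (A x0), (B x0). intros x L U.
  have EA : A x0 = A x.
  { apply (derive_zero_constant lo hi); try done.
    intros y Ly Uy. destruct (H y Ly Uy) as [D1 D2]. unfold A.
    auto_derive.
    - split; [by eexists; exact D1 | split; [by eexists; exact D2 | done]].
    - rewrite (is_derive_unique _ _ _ D1) (is_derive_unique _ _ _ D2). by field. }
  have EB : B x0 = B x.
  { apply (derive_zero_constant lo hi); try done.
    intros y Ly Uy. destruct (H y Ly Uy) as [D1 D2]. unfold B.
    auto_derive.
    - split; [by eexists; exact D1 | split; [by eexists; exact D2 | done]].
    - rewrite (is_derive_unique _ _ _ D1) (is_derive_unique _ _ _ D2). by field. }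
  rewrite EA EB /A /B.
  have T := sin2_cos2 (k * x). unfold Rsqr in T.
  transitivity (u x * (sin (k * x) * sin (k * x) + cos (k * x) * cos (k * x))).
  - rewrite T. ring.
  - by field.
Qed.

Lemma helmholtz_value (k : R) (lo hi : Rbar) (psi : R -> C) :
  k <> 0 -> helmholtz k lo hi psi ->
  exists w : C * C, forall x : R, Rbar_lt lo x -> Rbar_lt x hi ->
    psi x = value k w x.
Proof.
  intros Hk [dpsi H].
  destruct (helmholtz_real k lo hi (fun x => fst (psi x)) (fun x => fst (dpsi x)) Hk)
    as (a1 & b1 & H1).
  { intros x L U. destruct (H x L U) as [D1 D2]. split; first by apply is_derive_fst.
    move: (is_derive_fst _ _ _ D2). simpl. by rewrite Rmult_0_l Rminus_0_r. }
  destruct (helmholtz_real k lo hi (fun x => snd (psi x)) (fun x => snd (dpsi x)) Hk)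
    as (a2 & b2 & H2).
  { intros x L U. destruct (H x L U) as [D1 D2]. split; first by apply is_derive_snd.
    move: (is_derive_snd _ _ _ D2). simpl. by rewrite Rmult_0_l Rplus_0_r. }
  exists ((a1, a2), (b1, b2)). intros x L U.
  apply C_ext; rewrite ?H1 ?H2 //= ; ring.
Qed.

(** * Scattering solutions as families of waves *)

(** The vertex and endpoint conditions for the function equal to
    [value k (c e)] on every edge [e]; the left channel edge is entered against its
    coordinate, whence the minus sign. *)
Definition graph_waves (vt : vertex_type) (N : nat)
    (h l alpha beta theta1 theta2 theta3 k : R) (c : edge -> C * C) : Prop :=
  (forall j : nat, (1 <= j <= N)%nat ->
     vertex_relation vt theta1 theta2 theta3
       (value k (c (Channel (Nat.pred j))) (vertex_pos h j))
       (value k (c (Channel j)) (vertex_pos h j))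
       (value k (c (Resonator j)) 0)
       (- slope k (c (Channel (Nat.pred j))) (vertex_pos h j))
       (slope k (c (Channel j)) (vertex_pos h j))
       (slope k (c (Resonator j)) 0)) /\
  (forall j : nat, (1 <= j <= N)%nat ->
     (alpha * value k (c (Resonator j)) l + beta * slope k (c (Resonator j)) l = 0)%C).

(** e^(ikx) + r e^(-ikx) has cosine coefficient 1 + r and sine coefficient
    i (1 - r); t e^(ikx) has t and i t. *)
Definition scattering_waves (vt : vertex_type) (N : nat)
    (h l alpha beta theta1 theta2 theta3 k : R) (c : edge -> C * C) (r t : C) : Prop :=
  graph_waves vt N h l alpha beta theta1 theta2 theta3 k c /\
  c (Channel 0) = (1 + r, Ci * (1 - r))%C /\ c (Channel N) = (t, Ci * t)%C.

Lemma value_in (k : R) (r : C) (x : R) :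
  value k (1 + r, Ci * (1 - r))%C x = (cis (k * x) + r * cis (- (k * x)))%C.
Proof. apply C_ext; rewrite /value /cis /= cos_neg sin_neg; ring. Qed.

Lemma value_out (k : R) (t : C) (x : R) :
  value k (t, Ci * t)%C x = (t * cis (k * x))%C.
Proof. apply C_ext; rewrite /value /cis /=; ring. Qed.

Lemma end_data_value (k : R) (w : C * C) (a dir : R) :
  end_data (value k w) a dir (value k w a) (dir * slope k w a)%C.
Proof. apply end_data_derive, is_derive_value. Qed.

Lemma waves_scattering vt N h l alpha beta theta1 theta2 theta3 k c r t :
  scattering_waves vt N h l alpha beta theta1 theta2 theta3 k c r t ->
  scattering_solution vt N h l alpha beta theta1 theta2 theta3 k
    (fun e => value k (c e)) r t.
Proof.
  intros [[Hv He] [Hin Hout]]. split; [| split; [| split; [| split]]].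
  - intros e _. exists (slope k (c e)). intros x _ _.
    split; [apply is_derive_value | apply is_derive_slope].
  - intros j Hj. do 6 eexists.
    split; [apply end_data_value |]. split; [apply end_data_value |].
    split; [apply end_data_value |].
    replace (RtoC (-1) * slope k (c (Channel (Nat.pred j))) (vertex_pos h j))%C
      with (- slope k (c (Channel (Nat.pred j))) (vertex_pos h j))%C
      by (rewrite RtoC_m1; ring).
    rewrite !Cmult_1_l. by apply Hv.
  - intros j Hj. do 2 eexists. split; first apply end_data_value.
    rewrite -(He j Hj) RtoC_m1. ring.
  - intros x _. by rewrite Hin value_in.
  - intros x _. by rewrite Hout value_out.
Qed.

Lemma at_right_interior (lo hi : Rbar) (a dir d : R) :
  0 < d ->
  (forall eps, 0 < eps < d -> Rbar_lt lo (a + dir * eps) /\ Rbar_lt (a + dir * eps) hi) ->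
  forall (f g : R -> C), (forall x : R, Rbar_lt lo x -> Rbar_lt x hi -> f x = g x) ->
  at_right 0 (fun eps => f (a + dir * eps) = g (a + dir * eps)).
Proof.
  intros Hd H f g Hfg. exists (mkposreal d Hd). intros y Hy Hy0.
  move: Hy. rewrite /ball /= /AbsRing_ball /abs /minus /plus /opp /= => Hy.
  apply Rabs_lt_between in Hy.
  destruct (H y ltac:(lra)) as [A B]. by apply Hfg.
Qed.

(** On bounded edges the coefficients come from solving the equation on the open
    edge; on the leads they are read off the prescribed form.  The data at the ends
    are then forced because limits are unique. *)
Lemma scattering_to_waves vt N h l alpha beta theta1 theta2 theta3 k psi r t :
  (1 <= N)%nat -> 0 < h -> 0 < l -> 0 < k ->
  scattering_solution vt N h l alpha beta theta1 theta2 theta3 k psi r t ->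
  exists c, scattering_waves vt N h l alpha beta theta1 theta2 theta3 k c r t.
Proof.
  intros HN Hh Hl Hk (Hhelm & Hv & He & Hin & Hout).
  (* is_edge is a premise inside the existential, so that the choice of w depends
     on e alone. *)
  assert (Hw : forall e, exists w : C * C, is_edge N e ->
    (forall x : R, Rbar_lt (edge_lower h e) x -> Rbar_lt x (edge_upper N h l e) ->
       psi e x = value k w x) /\
    (e = Channel 0 -> w = (1 + r, Ci * (1 - r))%C) /\
    (e = Channel N -> w = (t, Ci * t)%C)).
  { intros e.
    destruct (classic (e = Channel 0)) as [-> | H0].
    { eexists. intros _. split; [| split; [reflexivity | intros E; injection E; lia]].
      intros x _ Hx. rewrite value_in. apply Hin.
      move: Hx. rewrite /edge_upper (proj2 (Nat.eqb_neq 0 N)); last lia.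
      rewrite /vertex_pos /=. lra. }
    destruct (classic (e = Channel N)) as [-> | H1].
    { eexists. intros _. split; [| split; [intros E; by case: (H0 E) | reflexivity]].
      intros x Hx _. rewrite value_out. apply Hout.
      move: Hx. destruct N as [| n]; first lia. simpl. lra. }
    destruct (classic (is_edge N e)) as [E | E].
    - destruct (helmholtz_value k _ _ _ ltac:(lra) (Hhelm e E)) as [w Hw].
      by exists w.
    - by exists (RtoC 0, RtoC 0). }
  pose (c := fun e => proj1_sig (constructive_indefinite_description _ (Hw e))).
  assert (Hc := fun e => proj2_sig (constructive_indefinite_description _ (Hw e))).
  fold c in Hc; change (forall e, is_edge N e ->
    (forall x : R, Rbar_lt (edge_lower h e) x -> Rbar_lt x (edge_upper N h l e) ->
       psi e x = value k (c e) x) /\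
    (e = Channel 0 -> c e = (1 + r, Ci * (1 - r))%C) /\
    (e = Channel N -> c e = (t, Ci * t)%C)) in Hc.
  clearbody c. exists c.
  assert (Hend : forall e a dir d p q, is_edge N e -> 0 < d ->
    (forall eps, 0 < eps < d -> Rbar_lt (edge_lower h e) (a + dir * eps) /\
       Rbar_lt (a + dir * eps) (edge_upper N h l e)) ->
    end_data (psi e) a dir p q ->
    p = value k (c e) a /\ q = (dir * slope k (c e) a)%C).
  { intros e a dir d p q E Hd Hint Hpq.
    apply: (end_data_unique (psi e) (value k (c e)) a dir); last 1 first.
    - apply end_data_value.
    - apply: (at_right_interior _ _ _ _ _ Hd Hint). by apply Hc.
    - exact Hpq. }
  split; [split |].
  (* A neighbourhood of size h inside channel edges and l inside resonators: the
     lengths of the bounded edges. *)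
  - intros j Hj. destruct (Hv j Hj) as (p1 & p2 & p3 & q1 & q2 & q3 & E1 & E2 & E3 & V).
    destruct j as [| i]; first lia. simpl Nat.pred in *.
    apply (Hend _ _ _ h) in E1; [| simpl; lia | done |]; last first.
    { intros eps Heps. split.
      - destruct i as [| i]; first done. rewrite /edge_lower /vertex_pos !S_INR /=. nra.
      - rewrite /edge_upper (proj2 (Nat.eqb_neq i N)); last lia. simpl. lra. }
    apply (Hend _ _ _ h) in E2; [| simpl; lia | done |]; last first.
    { intros eps Heps. split.
      - rewrite /edge_lower. simpl. lra.
      - rewrite /edge_upper. destruct (Nat.eqb (S i) N); first done.
        rewrite /vertex_pos !S_INR /=. nra. }
    apply (Hend _ _ _ l) in E3; [| simpl; lia | done |]; last first.
    { intros eps Heps. simpl. lra. }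
    destruct E1 as [-> ->], E2 as [-> ->], E3 as [-> ->].
    replace (- slope k (c (Channel i)) (vertex_pos h (S i)))%C with
     (RtoC (-1) * slope k (c (Channel i)) (vertex_pos h (S i)))%C
      by (rewrite RtoC_m1; ring).
    by rewrite !Cmult_1_l in V.
  - intros j Hj. destruct (He j Hj) as (p & q & E & V).
    apply (Hend _ _ _ l) in E; [| simpl; lia | done |]; last first.
    { intros eps Heps. simpl. lra. }
    destruct E as [-> ->]. rewrite -V RtoC_m1. ring.
  - split; apply Hc; simpl; try done; lia.
Qed.

(** * Symmetries of the wave equations *)

Definition lincomb (a b : C) (w v : C * C) : C * C :=
  (a * fst w + b * fst v, a * snd w + b * snd v)%C.
Definition conj_wave (w : C * C) : C * C := (Cconj (fst w), Cconj (snd w)).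
(** Coefficients of the wave x |-> value k w (L - x). *)
Definition mirror (k L : R) (w : C * C) : C * C :=
  (fst w * cos (k * L) + snd w * sin (k * L),
   fst w * sin (k * L) - snd w * cos (k * L))%C.

Lemma value_lincomb k a b w v x :
  value k (lincomb a b w v) x = (a * value k w x + b * value k v x)%C.
Proof. rewrite /value /lincomb /=. ring. Qed.
Lemma slope_lincomb k a b w v x :
  slope k (lincomb a b w v) x = (a * slope k w x + b * slope k v x)%C.
Proof. rewrite /slope /lincomb /=. ring. Qed.
Lemma value_conj k w x : value k (conj_wave w) x = Cconj (value k w x).
Proof. apply C_ext; rewrite /value /conj_wave /=; ring. Qed.
Lemma slope_conj k w x : slope k (conj_wave w) x = Cconj (slope k w x).
Proof. apply C_ext; rewrite /slope /conj_wave /=; ring. Qed.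
Lemma value_mirror k L w x : value k (mirror k L w) x = value k w (L - x).
Proof.
  rewrite /value /mirror /= Rmult_minus_distr_l cos_minus sin_minus.
  rewrite RtoC_plus RtoC_minus !RtoC_mult. ring.
Qed.
Lemma slope_mirror k L w x : slope k (mirror k L w) x = (- slope k w (L - x))%C.
Proof.
  rewrite /slope /mirror /= Rmult_minus_distr_l cos_minus sin_minus.
  rewrite RtoC_plus RtoC_minus !RtoC_mult. ring.
Qed.

Lemma Cdiv_lincomb (a b p p' d : C) :
  ((a * p + b * p') / d = a * (p / d) + b * (p' / d))%C.
Proof. rewrite /Cdiv. ring. Qed.

Lemma vertex_relation_lincomb vt theta1 theta2 theta3 (a b : C)
    p1 p2 p3 q1 q2 q3 p1' p2' p3' q1' q2' q3' :
  vertex_relation vt theta1 theta2 theta3 p1 p2 p3 q1 q2 q3 ->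
  vertex_relation vt theta1 theta2 theta3 p1' p2' p3' q1' q2' q3' ->
  vertex_relation vt theta1 theta2 theta3
    (a * p1 + b * p1') (a * p2 + b * p2') (a * p3 + b * p3')
    (a * q1 + b * q1') (a * q2 + b * q2') (a * q3 + b * q3').
Proof.
  destruct vt; intros (E1 & E2 & E3) (F1 & F2 & F3); rewrite /vertex_relation !Cdiv_lincomb;
  (split; [by rewrite E1 F1 | split; [by rewrite E2 F2 |]]).
  - transitivity (a * (theta1 * q1 + theta2 * q2 + theta3 * q3)
      + b * (theta1 * q1' + theta2 * q2' + theta3 * q3'))%C; first ring.
    rewrite E3 F3. ring.
  - transitivity (a * (theta1 * p1 + theta2 * p2 + theta3 * p3)
      + b * (theta1 * p1' + theta2 * p2' + theta3 * p3'))%C; first ring.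
    rewrite E3 F3. ring.
Qed.

Lemma Cconj_R (x : R) : Cconj x = x.
Proof. apply C_ext; simpl; ring. Qed.

Lemma Cconj_div_R (p : C) (x : R) : x <> 0 -> (Cconj p / x)%C = Cconj (p / x)%C.
Proof. intros H. rewrite Cdiv_conj ?Cconj_R //. by move=> /RtoC_inj. Qed.

Lemma Cconj_weighted_sum (x y z : R) (p q r : C) :
  (x * p + y * q + z * r = 0)%C ->
  (x * Cconj p + y * Cconj q + z * Cconj r = 0)%C.
Proof.
  intros E. rewrite -{1}(Cconj_R x) -{1}(Cconj_R y) -{1}(Cconj_R z).
  by rewrite -!Cmult_conj -!Cplus_conj E Cconj_R.
Qed.

Lemma vertex_relation_conj vt theta1 theta2 theta3 p1 p2 p3 q1 q2 q3 :
  theta1 <> 0 -> theta2 <> 0 -> theta3 <> 0 ->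
  vertex_relation vt theta1 theta2 theta3 p1 p2 p3 q1 q2 q3 ->
  vertex_relation vt theta1 theta2 theta3
    (Cconj p1) (Cconj p2) (Cconj p3) (Cconj q1) (Cconj q2) (Cconj q3).
Proof.
  intros H1 H2 H3.
  destruct vt; intros (E1 & E2 & E3); rewrite /vertex_relation !Cconj_div_R // E1 E2;
  (split; [done | split; [done |]]); by apply Cconj_weighted_sum.
Qed.

Lemma vertex_relation_swap vt theta1 theta2 theta3 p1 p2 p3 q1 q2 q3 :
  vertex_relation vt theta1 theta2 theta3 p1 p2 p3 q1 q2 q3 ->
  vertex_relation vt theta2 theta1 theta3 p2 p1 p3 q2 q1 q3.
Proof.
  destruct vt; intros (E1 & E2 & E3); (split; [by rewrite E1 | split; [by rewrite E1 |]]);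
  rewrite -E3; ring.
Qed.

Lemma graph_waves_lincomb vt N h l alpha beta theta1 theta2 theta3 k a b c c' :
  graph_waves vt N h l alpha beta theta1 theta2 theta3 k c ->
  graph_waves vt N h l alpha beta theta1 theta2 theta3 k c' ->
  graph_waves vt N h l alpha beta theta1 theta2 theta3 k
    (fun e => lincomb a b (c e) (c' e)).
Proof.
  intros [V E] [V' E']. split; intros j Hj; rewrite !value_lincomb !slope_lincomb.
  - replace (- (a * slope k (c (Channel (Nat.pred j))) (vertex_pos h j) +
       b * slope k (c' (Channel (Nat.pred j))) (vertex_pos h j)))%C
      with (a * - slope k (c (Channel (Nat.pred j))) (vertex_pos h j) +
       b * - slope k (c' (Channel (Nat.pred j))) (vertex_pos h j))%C by ring.
    apply vertex_relation_lincomb; auto.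
  - transitivity (a * 0 + b * 0)%C; last ring.
    rewrite -{1}(E j Hj) -(E' j Hj). ring.
Qed.

Lemma graph_waves_conj vt N h l alpha beta theta1 theta2 theta3 k c :
  theta1 <> 0 -> theta2 <> 0 -> theta3 <> 0 ->
  graph_waves vt N h l alpha beta theta1 theta2 theta3 k c ->
  graph_waves vt N h l alpha beta theta1 theta2 theta3 k (fun e => conj_wave (c e)).
Proof.
  intros H1 H2 H3 [V E]. split; intros j Hj; rewrite !value_conj !slope_conj.
  - rewrite -Copp_conj. apply vertex_relation_conj; auto.
  - rewrite -{1}(Cconj_R alpha) -{1}(Cconj_R beta).
    by rewrite -!Cmult_conj -!Cplus_conj (E j Hj) Cconj_R.
Qed.

Definition mirror_graph (N : nat) (h k : R) (c : edge -> C * C) (e : edge) : C * C :=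
  match e with
  | Channel j => mirror k (vertex_pos h N) (c (Channel (N - j)))
  | Resonator j => c (Resonator (N + 1 - j))
  end.

(** The reflection about the middle of the channel sends v_j to v_(N+1-j) and
    exchanges left and right there; resonators are carried along unchanged. *)
Lemma graph_waves_mirror vt N h l alpha beta theta1 theta2 theta3 k c :
  graph_waves vt N h l alpha beta theta1 theta2 theta3 k c ->
  graph_waves vt N h l alpha beta theta2 theta1 theta3 k (mirror_graph N h k c).
Proof.
  intros [V E]. split; intros j Hj; simpl.
  - rewrite !value_mirror !slope_mirror.
    replace (vertex_pos h N - vertex_pos h j) with (vertex_pos h (N + 1 - j)).
    2: { rewrite /vertex_pos minus_INR; last lia. rewrite plus_INR /=. ring. }
    apply vertex_relation_swap.
    replace (N - Nat.pred j)%nat with (N + 1 - j)%nat by lia.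
    replace (N - j)%nat with (Nat.pred (N + 1 - j)) by lia.
    replace (- - slope k (c (Channel (N + 1 - j))) (vertex_pos h (N + 1 - j)))%C
      with (slope k (c (Channel (N + 1 - j))) (vertex_pos h (N + 1 - j))) by ring.
    apply V. lia.
  - apply E. lia.
Qed.

(** * Flux conservation *)

(** Im (conj p * q): the probability current carried by the value p and the
    derivative q. *)
Definition flux (p q : C) : R := fst p * snd q - snd p * fst q.

(** The Wronskian of the real and imaginary parts is constant along an edge. *)
Lemma flux_value k w x :
  flux (value k w x) (slope k w x) = k * flux (fst w) (snd w).
Proof.
  rewrite /flux /value /slope /=.
  transitivity (k * (fst (fst w) * snd (snd w) - snd (fst w) * fst (snd w)) *
    (Rsqr (sin (k * x)) + Rsqr (cos (k * x)))).
  - rewrite /Rsqr. ring.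
  - rewrite sin2_cos2. ring.
Qed.

Lemma flux_Rmult (x : R) (p q : C) : flux (x * p) q = flux p (x * q).
Proof. rewrite /flux /=. ring. Qed.
Lemma flux_plus (p q q' : C) : flux p (q + q') = flux p q + flux p q'.
Proof. rewrite /flux /=. ring. Qed.
Lemma flux_sym (p q : C) : flux p q = - flux q p.
Proof. rewrite /flux /=. ring. Qed.
Lemma flux_opp (p q : C) : flux p (- q) = - flux p q.
Proof. rewrite /flux /=. ring. Qed.

(** The common ratio m of the vertex condition. *)
Lemma proportional (x y z : R) (p q r : C) : x <> 0 -> y <> 0 -> z <> 0 ->
  (p / x = q / y)%C -> (q / y = r / z)%C ->
  exists m : C, p = (x * m)%C /\ q = (y * m)%C /\ r = (z * m)%C.
Proof.
  intros Hx Hy Hz E1 E2. exists (p / x)%C.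
  have K : forall a : R, a <> 0 -> RtoC a <> 0 by move=> a Ha /RtoC_inj.
  split; [| split]; [| rewrite E1 | rewrite E1 E2]; field; by apply K.
Qed.

(** The sum is the flux of the common ratio m against x p' + y q' + z r' = 0. *)
Lemma flux_weighted (x y z : R) (p q r p' q' r' : C) : x <> 0 -> y <> 0 -> z <> 0 ->
  (p / x = q / y)%C -> (q / y = r / z)%C -> (x * p' + y * q' + z * r' = 0)%C ->
  flux p p' + flux q q' + flux r r' = 0.
Proof.
  intros Hx Hy Hz E1 E2 E3.
  destruct (proportional x y z p q r) as (m & -> & -> & ->); try done.
  rewrite !flux_Rmult -!flux_plus E3 /flux /=. ring.
Qed.

Lemma vertex_relation_flux vt theta1 theta2 theta3 p1 p2 p3 q1 q2 q3 :
  theta1 <> 0 -> theta2 <> 0 -> theta3 <> 0 ->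
  vertex_relation vt theta1 theta2 theta3 p1 p2 p3 q1 q2 q3 ->
  flux p1 q1 + flux p2 q2 + flux p3 q3 = 0.
Proof.
  intros H1 H2 H3. destruct vt; intros (E1 & E2 & E3).
  - by apply (flux_weighted theta1 theta2 theta3).
  - rewrite (flux_sym p1) (flux_sym p2) (flux_sym p3).
    have := flux_weighted theta1 theta2 theta3 q1 q2 q3 p1 p2 p3 H1 H2 H3 E1 E2 E3. lra.
Qed.

(** A real relation between p and q makes their complex directions parallel, so no
    flux leaves through the end of a resonator. *)
Lemma endpoint_flux (alpha beta : R) (p q : C) :
  (alpha, beta) <> (0, 0) -> (alpha * p + beta * q = 0)%C -> flux p q = 0.
Proof.
  intros Hab E.
  have E1 : alpha * fst p + beta * fst q = 0.
  { move: (f_equal fst E) => /=. lra. }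
  have E2 : alpha * snd p + beta * snd q = 0.
  { move: (f_equal snd E) => /=. lra. }
  have A : alpha * flux p q = 0.
  { transitivity (snd q * (alpha * fst p + beta * fst q)
      - fst q * (alpha * snd p + beta * snd q)); first (rewrite /flux; ring).
    rewrite E1 E2. ring. }
  have B : beta * flux p q = 0.
  { transitivity (fst p * (alpha * snd p + beta * snd q)
      - snd p * (alpha * fst p + beta * fst q)); first (rewrite /flux; ring).
    rewrite E1 E2. ring. }
  destruct (Req_dec alpha 0) as [-> | Ha]; [destruct (Req_dec beta 0) as [-> | Hb] |]; try done.
  - apply Rmult_integral in B. tauto.
  - apply Rmult_integral in A. tauto.
Qed.

Lemma flux_conservation vt N h l alpha beta theta1 theta2 theta3 k c :
  (alpha, beta) <> (0, 0) -> theta1 <> 0 -> theta2 <> 0 -> theta3 <> 0 -> k <> 0 ->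
  graph_waves vt N h l alpha beta theta1 theta2 theta3 k c ->
  forall j, (j <= N)%nat ->
    flux (fst (c (Channel j))) (snd (c (Channel j))) =
    flux (fst (c (Channel 0))) (snd (c (Channel 0))).
Proof.
  intros Hab H1 H2 H3 Hk [V E]. induction j as [| j IH]; intros Hj; first done.
  rewrite -IH; last lia.
  have Hj' : (1 <= S j <= N)%nat by lia.
  have F := vertex_relation_flux _ _ _ _ _ _ _ _ _ _ H1 H2 H3 (V _ Hj').
  have G := endpoint_flux _ _ _ _ Hab (E _ Hj').
  move: F G. rewrite flux_opp !flux_value /= => F G.
  apply (Rmult_eq_reg_l k); last done. lra.
Qed.

(** The flux is k (1 - |r|^2) on the left lead and k |t|^2 on the right lead. *)
Lemma scattering_unitary vt N h l alpha beta theta1 theta2 theta3 k c r t :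
  (alpha, beta) <> (0, 0) -> theta1 <> 0 -> theta2 <> 0 -> theta3 <> 0 -> k <> 0 ->
  scattering_waves vt N h l alpha beta theta1 theta2 theta3 k c r t ->
  (r * Cconj r + t * Cconj t = 1)%C.
Proof.
  intros Hab H1 H2 H3 Hk (G & Hin & Hout).
  have F := flux_conservation _ _ _ _ _ _ _ _ _ _ _ Hab H1 H2 H3 Hk G N (le_n N).
  move: F. rewrite Hin Hout /flux /= => F.
  apply C_ext; simpl; lra.
Qed.

(** * Reciprocity *)

(** In terms of X e^(-ikx) + Y e^(ikx) the coefficients of cos and sin are
    X + Y and i (Y - X); the reflection about L / 2 exchanges the two travelling
    waves and multiplies them by phases. *)
Lemma mirror_travelling k L (X Y : C) :
  mirror k L (X + Y, Ci * (Y - X))%C =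
  (X * cis (- (k * L)) + Y * cis (k * L),
   Ci * (X * cis (- (k * L)) - Y * cis (k * L)))%C.
Proof.
  rewrite /mirror /cis cos_neg sin_neg.
  apply injective_projections; apply C_ext; simpl; ring.
Qed.

Lemma cis_mult_opp (y : R) : (cis y * cis (- y) = 1)%C.
Proof.
  rewrite /cis cos_neg sin_neg. have := sin2_cos2 y. rewrite /Rsqr => T.
  apply C_ext; simpl; lra.
Qed.

(** Reflect conj psi - conj r psi and normalize it.  The factor a = e^(ikL) / conj t,
    with L = (N-1)h, makes the new incoming amplitude equal to 1; the outgoing one is
    (1 - |r|^2) / conj t, which is t by unitarity. *)
Lemma reciprocity vt N h l alpha beta theta1 theta2 theta3 k c r t :
  (alpha, beta) <> (0, 0) -> theta1 <> 0 -> theta2 <> 0 -> theta3 <> 0 -> k <> 0 ->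
  scattering_waves vt N h l alpha beta theta1 theta2 theta3 k c r t ->
  t <> 0 ->
  exists c' r', scattering_waves vt N h l alpha beta theta2 theta1 theta3 k c' r' t.
Proof.
  intros Hab H1 H2 H3 Hk S Ht.
  have U := scattering_unitary _ _ _ _ _ _ _ _ _ _ _ _ _ Hab H1 H2 H3 Hk S.
  destruct S as (G & Hin & Hout).
  set z := cis (k * vertex_pos h N). set z' := cis (- (k * vertex_pos h N)).
  have Hz : (z * z' = 1)%C by apply cis_mult_opp.
  have Ht' : Cconj t <> 0.
  { move=> E. apply Ht. rewrite -(Cconj_conj t) E. apply C_ext; simpl; ring. }
  set a := (z / Cconj t)%C.
  have Ha : (a * Cconj t * z' = 1)%C by rewrite /a -Hz; field.
  exists (mirror_graph N h k (fun e => lincomb a (- a * Cconj r) (conj_wave (c e)) (c e))),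
    (- a * Cconj r * t * z)%C.
  split; [| split].
  - apply graph_waves_mirror, graph_waves_lincomb; last done. by apply graph_waves_conj.
  - rewrite /mirror_graph Nat.sub_0_r Hout /lincomb /conj_wave /=.
    replace (a * Cconj t + - a * Cconj r * t,
      a * Cconj (Ci * t) + - a * Cconj r * (Ci * t))%C with
      (a * Cconj t + - a * Cconj r * t, Ci * (- a * Cconj r * t - a * Cconj t))%C.
    2: { f_equal. replace (Cconj (Ci * t)) with (- Ci * Cconj t)%C; first ring.
         apply C_ext; simpl; ring. }
    rewrite mirror_travelling -/z -/z' Ha. done.
  - rewrite /mirror_graph Nat.sub_diag Hin /lincomb /conj_wave /=.
    set X := (a * (1 - r * Cconj r))%C.
    have HX : (X * z' = t)%C.
    { rewrite /X. replace (1 - r * Cconj r)%C with (t * Cconj t)%C.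
      - transitivity (t * (a * Cconj t * z'))%C; first ring. rewrite Ha. ring.
      - rewrite -U. ring. }
    transitivity (mirror k (vertex_pos h N) (X + 0, Ci * (0 - X))%C).
    + f_equal. rewrite /X.
      have -> : Cconj (1 + r) = (1 + Cconj r)%C by apply C_ext; simpl; ring.
      have -> : Cconj (Ci * (1 - r)) = (- Ci * (1 - Cconj r))%C by apply C_ext; simpl; ring.
      f_equal; ring.
    + rewrite mirror_travelling -/z -/z' HX. f_equal; ring.
Qed.

(** * Zero transmission *)

(** A standing wave in a resonator that meets the endpoint condition and whose
    data at the vertex make the channel see a wall: Dirichlet for type I, Neumann
    for type II.  Only its amplitude can balance the
    vertex condition when a nonzero wave arrives and nothing leaves. *)
Definition blocking_mode (vt : vertex_type) (l alpha beta k : R) (w : C * C) : Prop :=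
  (alpha * value k w l + beta * slope k w l = 0)%C /\
  match vt with
  | TypeI => value k w 0 = 0 /\ slope k w 0 <> 0
  | TypeII => slope k w 0 = 0 /\ value k w 0 <> 0
  end.

Lemma Cmult_eq_0_reg_l (a b : C) : a <> 0 -> (a * b = 0)%C -> b = 0.
Proof.
  intros Ha E. transitivity (/ a * (a * b))%C; first by field.
  rewrite E. ring.
Qed.

Lemma wave_zero k w x : k <> 0 -> value k w x = 0 -> slope k w x = 0 ->
  w = (RtoC 0, RtoC 0).
Proof.
  intros Hk Hv Hs.
  have Hk' : RtoC k <> 0 by move=> /RtoC_inj.
  have T : (RtoC (sin (k * x)) * sin (k * x) + cos (k * x) * cos (k * x) = 1)%C.
  { rewrite -!RtoC_mult -RtoC_plus. f_equal. apply sin2_cos2. }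
  have Hs' : (snd w * cos (k * x) - fst w * sin (k * x) = 0)%C.
  { exact: (Cmult_eq_0_reg_l _ _ Hk'). }
  apply injective_projections; simpl.
  - transitivity (value k w x * cos (k * x) -
      (snd w * cos (k * x) - fst w * sin (k * x)) * sin (k * x))%C.
    + rewrite -{1}(Cmult_1_r (fst w)) -T /value. ring.
    + rewrite Hv Hs'. ring.
  - transitivity (value k w x * sin (k * x) +
      (snd w * cos (k * x) - fst w * sin (k * x)) * cos (k * x))%C.
    + rewrite -{1}(Cmult_1_r (snd w)) -T /value. ring.
    + rewrite Hv Hs'. ring.
Qed.

(** At a vertex with zero data on the right channel edge the common ratio vanishes,
    so the weighted sum only relates the left edge and the resonator. *)
Lemma weighted_blocked (x y z : R) (p r p' r' : C) : x <> 0 -> y <> 0 -> z <> 0 ->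
  (p / x = 0 / y)%C -> (0 / y = r / z)%C -> (x * p' + y * 0 + z * r' = 0)%C ->
  p = 0 /\ r = 0 /\ (r' = 0 -> p' = 0).
Proof.
  intros Hx Hy Hz E1 E2 E3.
  have Hx' : RtoC x <> 0 by move=> /RtoC_inj.
  have Hy' : RtoC y <> 0 by move=> /RtoC_inj.
  destruct (proportional x y z p 0 r) as (m & -> & Em & ->); try done.
  have -> : m = 0.
  { exact: (Cmult_eq_0_reg_l _ _ Hy'). }
  split; [ring | split; [ring |]]. intros ->.
  apply: (Cmult_eq_0_reg_l _ _ Hx'). rewrite -E3. ring.
Qed.

(** Backward induction along the channel: unless a resonator holds a blocking mode,
    zero data to the right of a vertex force zero data to its left. *)
Lemma zero_transmission_blocked vt N h l alpha beta theta1 theta2 theta3 k c :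
  theta1 <> 0 -> theta2 <> 0 -> theta3 <> 0 -> k <> 0 ->
  graph_waves vt N h l alpha beta theta1 theta2 theta3 k c ->
  c (Channel N) = (RtoC 0, RtoC 0) ->
  (exists w, blocking_mode vt l alpha beta k w) \/ c (Channel 0) = (RtoC 0, RtoC 0).
Proof.
  intros H1 H2 H3 Hk [V E] Hout.
  destruct (classic (exists w, blocking_mode vt l alpha beta k w)) as [B | B]; [by left | right].
  assert (K : forall m, (m <= N)%nat -> c (Channel (N - m)) = (RtoC 0, RtoC 0)).
  { induction m as [| m IH]; intros Hm; first by rewrite Nat.sub_0_r.
    have Hj : (1 <= N - m <= N)%nat by lia.
    have Z := IH ltac:(lia).
    have Vj := V _ Hj. have Ej := E _ Hj.
    replace (N - S m)%nat with (Nat.pred (N - m)) by lia.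
    rewrite Z in Vj.
    have Z1 : value k (RtoC 0, RtoC 0) (vertex_pos h (N - m)) = 0 by rewrite /value /=; ring.
    have Z2 : slope k (RtoC 0, RtoC 0) (vertex_pos h (N - m)) = 0 by rewrite /slope /=; ring.
    rewrite Z1 Z2 in Vj.
    set x := vertex_pos h (N - m) in Vj. set w := c (Channel _) in Vj |- *.
    set u := c (Resonator _) in Vj Ej.
    have Op : forall a : C, (- a)%C = 0 -> a = 0.
    { intros a Ha. transitivity (- - a)%C; first ring. rewrite Ha. ring. }
    destruct vt; destruct Vj as (V1 & V2 & V3);
    destruct (weighted_blocked _ _ _ _ _ _ _ H1 H2 H3 V1 V2 V3) as (P & Q & D);
    apply (wave_zero k w x Hk); auto.
    - apply Op, D. apply NNPP. intros Hu. apply B. by exists u.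
    - apply D. apply NNPP. intros Hu. apply B. by exists u. }
  rewrite -(Nat.sub_diag N). by apply K.
Qed.

(** The explicit solution lives on the left lead and the first resonator only: the
    lead carries the standing wave 2i sin(kx) (type I, r = -1) or 2 cos(kx) (type II,
    r = 1), and the mode is scaled so that the weighted sum at v_1 vanishes. *)
Lemma total_reflection vt N h l alpha beta theta1 theta2 theta3 k w :
  (1 <= N)%nat -> theta3 <> 0 -> blocking_mode vt l alpha beta k w ->
  exists c r, scattering_waves vt N h l alpha beta theta1 theta2 theta3 k c r 0.
Proof.
  intros HN H3 [E B].
  have H3' : RtoC theta3 <> 0 by move=> /RtoC_inj.
  pose (c (r s : C) (e : edge) := match e with
    | Channel O => (1 + r, Ci * (1 - r))%C
    | Resonator 1%nat => lincomb s 0 w w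
    | _ => (RtoC 0, RtoC 0)
    end).
  assert (Z1 : forall x, value k (RtoC 0, RtoC 0) x = 0) by (intros; rewrite /value /=; ring).
  assert (Z2 : forall x, slope k (RtoC 0, RtoC 0) x = 0) by (intros; rewrite /slope /=; ring).
  assert (K : forall r s,
    vertex_relation vt theta1 theta2 theta3 (1 + r) 0 (s * value k w 0)
      (- (k * (Ci * (1 - r)))) 0 (s * slope k w 0) ->
    scattering_waves vt N h l alpha beta theta1 theta2 theta3 k (c r s) r 0).
  { intros r s V. split; [split |].
    - intros j Hj. destruct j as [| [| j]]; first lia.
      + have -> : vertex_pos h 1 = 0 by rewrite /vertex_pos /=; ring.
        rewrite /= Z1 Z2 value_lincomb slope_lincomb.
        rewrite /value /slope /= in V |- *.
        move: V. rewrite !Rmult_0_r cos_0 sin_0 => V.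
        match goal with |- vertex_relation _ _ _ _ ?p1 _ ?p3 ?q1 _ ?q3 =>
          match type of V with vertex_relation _ _ _ _ ?p1' _ ?p3' ?q1' _ ?q3' =>
          replace p1 with p1' by ring; replace p3 with p3' by ring;
          replace q1 with q1' by ring; replace q3 with q3' by ring end end.
        exact V.
      + rewrite /= !Z1 !Z2. replace (- 0)%C with (RtoC 0) by ring.
        destruct vt; rewrite /vertex_relation /Cdiv; (split; [ring | split; ring]).
    - intros j Hj. destruct j as [| [| j]]; first lia.
      + rewrite /= value_lincomb slope_lincomb. 
        transitivity (s * (alpha * value k w l + beta * slope k w l))%C; first ring.
        rewrite E. ring.
      + rewrite /= Z1 Z2. ring.
    - split; first done. destruct N as [| n]; first lia. simpl. f_equal; ring. }
  destruct vt; destruct B as [B1 B2].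
  - exists (c (-1)%C (2 * Ci * k * theta1 / (theta3 * slope k w 0))%C), (-1)%C.
    apply K. rewrite B1 RtoC_m1. split; [| split]; rewrite /Cdiv; try ring.
    field. by split.
  - exists (c 1 (- 2 * theta1 / (theta3 * value k w 0))%C), 1.
    apply K. rewrite B1. split; [| split]; rewrite /Cdiv; try ring.
    field. by split.
Qed.

(** * Invariance under interchange *)

Lemma swap_scattering_solution vt N h l alpha beta theta1 theta2 theta3 k t :
  (1 <= N)%nat -> 0 < h -> 0 < l -> (alpha, beta) <> (0, 0) ->
  theta1 * theta2 * theta3 <> 0 -> 0 < k ->
  (exists psi r, scattering_solution vt N h l alpha beta theta1 theta2 theta3 k psi r t) ->
  exists psi r, scattering_solution vt N h l alpha beta theta2 theta1 theta3 k psi r t.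
Proof.
  intros HN Hh Hl Hab Htheta Hk (psi & r & Hpsi).
  have H1 : theta1 <> 0 by nra. have H2 : theta2 <> 0 by nra. have H3 : theta3 <> 0 by nra.
  have Hk0 : k <> 0 by lra.
  destruct (scattering_to_waves _ _ _ _ _ _ _ _ _ _ _ _ _ HN Hh Hl Hk Hpsi) as [c Hc].
  enough (exists c' r', scattering_waves vt N h l alpha beta theta2 theta1 theta3 k c' r' t)
    as (c' & r' & Hc').
  { exists (fun e => value k (c' e)), r'. by apply waves_scattering. }
  destruct (classic (t = 0)) as [-> | Ht].
  - destruct Hc as (G & Hin & Hout).
    destruct (zero_transmission_blocked _ _ _ _ _ _ _ _ _ _ _ H1 H2 H3 Hk0 G) as [[w B] | Z].
    + rewrite Hout. f_equal. ring.
    + by apply (total_reflection _ _ _ _ _ _ _ _ _ _ w).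
    + exfalso. rewrite Hin in Z. injection Z. simpl. lra.
  - exact: (reciprocity _ _ _ _ _ _ _ _ _ _ _ _ _ Hab H1 H2 H3 Hk0 Hc Ht).
Qed.

Theorem mainTheorem10 (vt : vertex_type) (N : nat)
    (h l alpha beta theta1 theta2 theta3 : R)
    (HN : (1 <= N)%nat) (Hh : 0 < h) (Hl : 0 < l)
    (Hab : (alpha, beta) <> (0, 0))
    (Htheta : theta1 * theta2 * theta3 <> 0) :
  forall k : R, 0 < k ->
    transmission_probability vt N h l alpha beta theta1 theta2 theta3 k =
    transmission_probability vt N h l alpha beta theta2 theta1 theta3 k.
Proof.
  intros k Hk. unfold transmission_probability, transmission_amplitude.
  do 3 f_equal. apply functional_extensionality. intros t.
  apply propositional_extensionality.
  split; apply swap_scattering_solution; try assumption. by rewrite (Rmult_comm theta2).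
Qed.
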